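(* Let $f:\mathbb{R}^n\to\mathbb{R}\cup\{\infty\}$ be convex and differentiable, let $X\subseteq\mathrm{dom}(f)$ be convex, and let $h:\mathbb{R}^n\to\mathbb{R}\cup\{\infty\}$ be convex and differentiable on $X$, with Bregman distance $D_h$. Suppose $f^\star:=\min_{x\in X}f(x)$ is finite, $X^\star:=\{x\in X:f(x)=f^\star\}\ne\emptyset$, and the map $x\mapsto\bar x:=\mathrm{argmin}_{y\in X^\star}D_h(y,x)$ is well defined for all $x\in X$. Suppose $L:=L_{f,X,D_h}<\infty$ and $\mu:=\mu^\sharp_{f,X,D_h}>0$. Let $x_0\in X$ and let $x_k$, $k=0,1,\dots$, be the iterates generated by the mirror descent algorithm \[ x_{k+1}=\mathrm{argmin}_{y\in X}\{\langle\nabla f(x_k),y\rangle+L_k\,D_h(y,x_k)\},\qquad k=0,1,\dots \] with $L_k=L$ for $k=0,1,\dots$. Then for $K=\lceil 2L/\mu\rceil$, \[ D_h(X^\star,x_{k+K})\le\frac{D_h(X^\star,x_k)}{2}\quad\text{for }k=0,1,2,\dots. \] In addition, the algorithm yields $x_k\in X$ such that $f(x_k)-f^\star<\epsilon$ in at most \[ \mathcal{O}\left(\frac{L}{\mu}\log\left(\frac{L\,D_h(X^\star,x_0)}{\epsilon}\right)\right) \] iterations.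
   Context: Bregman distances: $D_f(y,x)=f(y)-f(x)-\langle\nabla f(x),y-x\rangle$ and likewise $D_h(y,x)=h(y)-h(x)-\langle\nabla h(x),y-x\rangle$ for $x,y\in X$; $D_h(X^\star,x):=\inf_{y\in X^\star}D_h(y,x)$. The Bregman proximal map $g\mapsto\mathrm{argmin}_{y\in X}\{\langle g,y\rangle+L\,D_h(y,x)\}$ is assumed computable for $x\in X$ and $L>0$; the algorithm's parameters satisfy $L_k>0$. Relative smoothness constant and relative functional growth constant: \[ L_{f,X,D_h}:=\inf\{L>0:\ D_f(y,x)\le L\,D_h(y,x)\ \forall x,y\in X\}, \] \[ \mu^\sharp_{f,X,D_h}:=\sup\{\mu\ge0:\ f(x)-f^\star\ge\mu\,D_h(\bar x,x)\ \forall x\in X\}. \] *)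

(* Defs.v *)
From HB Require Import structures.
From mathcomp Require Import all_boot all_order all_algebra.
From mathcomp Require Import all_classical all_reals all_analysis.

Set Implicit Arguments.
Unset Strict Implicit.
Unset Printing Implicit Defensive.

Import Order.TTheory GRing.Theory Num.Theory.
Import numFieldNormedType.Exports.

Local Open Scope classical_set_scope.
Local Open Scope ring_scope.

(* R^n is 'rV[R]_n, and a function R^n -> R U {oo} is a
   function 'rV[R]_n -> \bar R that never takes the value -oo. *)

Definition argmin (T : Type) (R : realType) (A : set T) (g : T -> R) : set T :=
  [set y | A y /\ forall z, A z -> g y <= g z].

Section Bregman.
Variables (R : realType) (n : nat).
Implicit Types (f h : 'rV[R]_n -> \bar R) (X : set 'rV[R]_n) (x y : 'rV[R]_n).

Definition dotv (u v : 'rV[R]_n) : R := \sum_(i < n) u ord0 i * v ord0 i.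

Definition edom f : set 'rV[R]_n := [set x | (f x < +oo)%E].

(* The products and sums are taken in \bar R, where 0 * +oo = 0. *)
Definition econvex_on X f : Prop :=
  forall x y (t : R), X x -> X y -> 0 <= t -> t <= 1 ->
    (f (t *: x + (1 - t) *: y)%R <= t%:E * f x + (1 - t)%:E * f y)%E.

(* Frechet differentiability of an extended-valued function, which as usual
   requires finiteness around the point; [differentiable] itself is only
   available for functions with values in a normed space. *)
Definition ediff f x : Prop :=
  (\forall z \near x, f z \is a fin_num) /\ differentiable (fine \o f) x.

Definition grad f x : 'rV[R]_n :=
  \row_(i < n) 'D_(delta_mx ord0 i) (fine \o f) x.

(* D_f(y, x); only used at points where f is finite. *)
Definition bregman f y x : R :=
  fine (f y) - fine (f x) - dotv (grad f x) (y - x).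

Definition fmin f X : \bar R := ereal_inf (f @` X).

Definition Xstar f X : set 'rV[R]_n := [set x | X x /\ f x = fmin f X].

(* D_h(A, x) = inf_{y in A} D_h(y, x) *)
Definition bregman_set h (A : set 'rV[R]_n) x : \bar R :=
  ereal_inf [set (bregman h y x)%:E | y in A].

(* The map x |-> bar x; [get] picks the minimizer, whose existence and
   uniqueness is what [bregman_proj_defined] states. *)
Definition bregman_proj f h X x : 'rV[R]_n :=
  get (argmin (Xstar f X) (fun y => bregman h y x)).

Definition bregman_proj_defined f h X : Prop :=
  forall x, X x -> exists! y, argmin (Xstar f X) (fun y => bregman h y x) y.

(* Both constants are extended reals, so that they are defined without
   assuming that the set is nonempty (first) or bounded (second). *)
Definition rel_smoothness f h X : \bar R :=
  ereal_inf [set L%:E | L in [set L : R | 0 < L /\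
    forall x y, X x -> X y -> bregman f y x <= L * bregman h y x]].

Definition rel_growth f h X : \bar R :=
  ereal_sup [set mu%:E | mu in [set mu : R | 0 <= mu /\
    forall x, X x ->
      ((mu * bregman h (bregman_proj f h X x) x)%:E <= f x - fmin f X)%E]].

Definition mirror_descent f h X (Lk : nat -> R) (x : nat -> 'rV[R]_n) : Prop :=
  X (x 0%N) /\
  forall k, 0 < Lk k /\
    argmin X (fun y => dotv (grad f (x k)) y + Lk k * bregman h y (x k))
      (x k.+1).

End Bregman.

(* Main.v *)
Require Import Defs.
From HB Require Import structures.
From mathcomp Require Import all_boot all_order all_algebra.
From mathcomp Require Import all_classical all_reals all_analysis.
From mathcomp Require Import ring lra.

(* Write D(x) for D_h(X*, x).  Relative smoothness of f, convexity of f and the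
   three-point inequality for the Bregman proximal step give
     L D_h(y, x_{k+1}) <= L D_h(y, x_k) - (f(x_{k+1}) - f(y))   for y in X.
   With y the projection of x_k on X* this bounds both
   f(x_{k+1}) - f* <= L D(x_k) and, by relative growth at x_{k+1},
   (L + mu) D(x_{k+1}) <= L D(x_k).  The halving follows from
   (1 + mu/L)^K >= 1 + K mu/L, and the iteration bound from
   L/(L + mu) <= exp(-1/(L/mu + 1)).  If mu = +oo, then D vanishes on X. *)

Set Implicit Arguments.
Unset Strict Implicit.
Unset Printing Implicit Defensive.

Import Order.TTheory GRing.Theory Num.Theory.
Import numFieldNormedType.Exports.

Local Open Scope classical_set_scope.
Local Open Scope ring_scope.

(** The derivative is also the limit of the difference quotients from the right, so steps in (0, 1]
    suffice. With [v] = y - x, such steps stay in any convex set containing x and y. *)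
Lemma derive_ge (R : realType) (V : normedModType R) (F : V -> R) (x v : V)
    (c : R) :
  derivable F x v ->
  (forall t, 0 < t -> t <= 1 -> t * c <= F (x + t *: v) - F x) ->
  c <= 'D_v F x.
Proof.
move=> dF Fc; have /cvg_dnbhs_at_right Fcvg : derivable F x v := dF.
apply: (cvgr_to_ge Fcvg); near=> t.
have t0 : 0 < t by near: t; exact: nbhs_right_gt.
rewrite /= [_ + x]addrC.
have -> : t^-1 *: (F (x + t *: v) - F x) = t^-1 * (F (x + t *: v) - F x) by [].
rewrite ler_pdivlMl//; apply: Fc => //.
near: t; exact: nbhs_right_le.
Unshelve. all: by end_near. Qed.

(** * First-order inequalities for Bregman distances on a convex set *)

Section bregman_theory.
Variables (R : realType) (n : nat).
Implicit Types (f h : 'rV[R]_n -> \bar R) (X : set 'rV[R]_n).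
Implicit Types (x y z u v w : 'rV[R]_n).

Lemma dotvDr u v w : dotv u (v + w) = dotv u v + dotv u w.
Proof.
by rewrite /dotv -big_split; apply: eq_bigr => i _; rewrite !mxE mulrDr.
Qed.

Lemma dotvBr u v w : dotv u (v - w) = dotv u v - dotv u w.
Proof. by rewrite /dotv -sumrB; apply: eq_bigr => i _; rewrite !mxE mulrBr. Qed.

Lemma dotvZr u v (t : R) : dotv u (t *: v) = t * dotv u v.
Proof.
by rewrite /dotv mulr_sumr; apply: eq_bigr => i _; rewrite !mxE mulrCA.
Qed.

Lemma dotv_grad f x v : ediff f x ->
  dotv (grad f x) v = 'D_v (fine \o f) x.
Proof.
move=> [_ df]; rewrite deriveE// {2}[v]row_sum_delta linear_sum.
apply: eq_bigr => i _; rewrite linearZ mxE deriveE//.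
by rewrite mulrC; congr (_ * _); congr (v _ _); exact: ord1.
Qed.

Lemma ediff_fin f x : ediff f x -> f x \is a fin_num.
Proof. by move=> [/nbhs_singleton]. Qed.

Lemma convex_set_comb X x y (t : R) :
  convex_set (X : set (convex_lmodType 'rV[R]_n)) ->
  X x -> X y -> 0 <= t -> t <= 1 -> X (x + t *: (y - x)).
Proof.
move=> cX Xx Xy t0 t1.
have := cX y x (Itv01 t0 t1); rewrite !inE => /(_ Xy Xx).
congr (X _); rewrite /conv/=.
by rewrite /unstable.onem scalerBl scale1r scalerBr addrCA.
Qed.

Lemma econvex_on_fine X f x y (t : R) :
  econvex_on X f -> convex_set (X : set (convex_lmodType 'rV[R]_n)) ->
  (forall z, X z -> f z \is a fin_num) ->
  X x -> X y -> 0 <= t -> t <= 1 ->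
  fine (f (x + t *: (y - x))) <= fine (f x) + t * (fine (f y) - fine (f x)).
Proof.
move=> cf cX ff Xx Xy t0 t1; have := cf y x t Xy Xx t0 t1.
have -> : t *: y + (1 - t) *: x = x + t *: (y - x).
  by rewrite scalerBl scale1r scalerBr addrCA.
rewrite -(fineK (ff _ (convex_set_comb cX Xx Xy t0 t1))).
rewrite -(fineK (ff _ Xx)) -(fineK (ff _ Xy)) -!EFinM -EFinD lee_fin /=.
by move=> /le_trans; apply; lra.
Qed.

Lemma bregman_ge0 X f x y :
  econvex_on X f -> convex_set (X : set (convex_lmodType 'rV[R]_n)) ->
  (forall z, X z -> ediff f z) -> X x -> X y -> 0 <= bregman f y x.
Proof.
move=> cf cX df Xx Xy; rewrite /bregman dotv_grad; last exact: df.
(* [derive_ge] bounds from below, so it is applied to -f, whose difference quotients along y - x are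
   at least f(x) - f(y) by convexity. *)
rewrite subr_ge0 -lerN2 -deriveN; last exact/diff_derivable/(df _ Xx).2.
apply: derive_ge; first exact/derivableN/diff_derivable/(df _ Xx).2.
move=> t t0 t1.
have fin z : X z -> f z \is a fin_num by move=> /df /ediff_fin.
have := econvex_on_fine cf cX fin Xx Xy (ltW t0) t1.
rewrite !fctE/=; lra.
Qed.

(* The three-point inequality: the first-order condition at the minimizer z,
   rewritten with the identity expressing D_h(y,x) - D_h(y,z) - D_h(z,x) as an
   inner product of gradients. *)
Lemma bregman_argmin X h (g : 'rV[R]_n) (l : R) x z y :
  convex_set (X : set (convex_lmodType 'rV[R]_n)) -> 0 < l -> ediff h z ->
  argmin X (fun y => dotv g y + l * bregman h y x) z -> X y ->
  dotv g z + l * bregman h z x + l * bregman h y z <=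
  dotv g y + l * bregman h y x.
Proof.
move=> cX l0 dh [Xz zmin] Xy.
(* Optimality of [z] divided by [l]: the right side is a derivative of [h] alone, and [derive_ge]
   tests it on steps from [z] towards [y] inside [X]. *)
have : dotv (grad h x) (y - z) - l^-1 * dotv g (y - z) <=
    dotv (grad h z) (y - z).
  rewrite [leRHS]dotv_grad//; apply: derive_ge.
    exact/diff_derivable/dh.2.
  move=> t t0 t1; have := zmin _ (convex_set_comb cX Xz Xy (ltW t0) t1).
  rewrite -(ler_pM2l l0) /bregman /=.
  rewrite !(dotvBr, dotvDr, dotvZr).
  have -> : l * (t * (dotv (grad h x) y - dotv (grad h x) z -
                      l^-1 * (dotv g y - dotv g z))) =
            l * t * (dotv (grad h x) y - dotv (grad h x) z) -
            t * (dotv g y - dotv g z).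
    by field; exact: lt0r_neq0.
  lra.
rewrite -(ler_pM2l l0) mulrBr mulrA mulfV ?lt0r_neq0// mul1r.
rewrite /bregman !dotvBr; lra.
Qed.

End bregman_theory.

(** * Decay rates for real sequences [d] (distance) and [e] (gap) *)

Section rates.
Variables (R : realType) (L r : R) (d e : nat -> R).
Hypotheses (L_gt0 : 0 < L) (r_gt0 : 0 < r) (d_ge0 : forall k, 0 <= d k).
Hypothesis d_descent : forall k, L * d k.+1 <= L * d k - e k.+1.
Hypothesis growth : forall k, r * d k <= e k.

Let contraction k : (L + r) * d k.+1 <= L * d k.
Proof. by have := d_descent k; have := growth k.+1; lra. Qed.

(** Bernoulli's inequality with denominators cleared: the induction step rests on L (L + (j + 1) r)
    <= (L + j r) (L + r), where the two sides differ by j r^2. *)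
Lemma descent_linear_decay j k : (L + j%:R * r) * d (k + j)%N <= L * d k.
Proof.
elim: j => [|j IHj]; first by rewrite addn0 mul0r addr0.
have j0 : 0 <= j%:R * r by rewrite mulr_ge0 ?ler0n ?ltW.
apply: le_trans IHj; rewrite addnS -(ler_pM2l L_gt0).
have /(ler_wpM2l (addr_ge0 (ltW L_gt0) j0)) := contraction (k + j).
rewrite [in X in _ -> _ <= X]mulrCA; apply: le_trans.
rewrite -natr1 !mulrA ler_wpM2r//.
have : 0 <= j%:R * r * r by rewrite mulr_ge0 ?(ltW r_gt0).
lra.
Qed.

Lemma descent_halving j k : 2 * L <= j%:R * r -> d (k + j)%N <= d k / 2.
Proof.
(* Here L + j r >= 3 L, so the decay factor is even 1/3. *)
move=> jr; have := descent_linear_decay j k.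
have : 2 * L * d (k + j)%N <= j%:R * r * d (k + j)%N by rewrite ler_wpM2r.
have := mulr_ge0 (ltW L_gt0) (d_ge0 (k + j)) => Ld0 le1 le2.
by rewrite -(ler_pM2l L_gt0); lra.
Qed.

Lemma descent_exp_decay k : d k <= d 0%N * expR (- (k%:R / (L / r + 1))).
Proof.
elim: k => [|k IHk]; first by rewrite mul0r oppr0 expR0 mulr1.
have Lr_gt0 : 0 < L / r + 1 by rewrite addr_gt0// divr_gt0.
rewrite -natr1 mulrDl opprD expRD mulrA.
have step : d k.+1 <= d k * (1 - 1 / (L / r + 1)).
  have -> : 1 - 1 / (L / r + 1) = L / (L + r).
    by field; rewrite !lt0r_neq0//= addr_gt0.
  by rewrite mulrA ler_pdivlMr ?addr_gt0// mulrC [leRHS]mulrC.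
apply: (le_trans step); apply: ler_pM => //; last exact: expR_ge1Dx.
by rewrite subr_ge0 ler_pdivrMr// mul1r lerDr divr_ge0 ?ltW.
Qed.

(** With q = L d_0 / eps, any m > (L/r + 1) ln q gives L d_m < eps, and e_{m+1} <= L d_m costs one
    more step. In the constant, [1] pays for (L/r) ln q, [delta^-1] for the remaining ln q, and the
    last term for the 2 lost to rounding and the extra step. *)
Lemma descent_iteration_bound (eps delta : R) :
  0 < eps -> 0 < delta -> delta <= L / r -> 1 + delta <= L * d 0%N / eps ->
  exists2 k, k%:R <= (1 + delta^-1 + 2 / (delta * ln (1 + delta))) *
                       (L / r * ln (L * d 0%N / eps)) & e k < eps.
Proof.
move=> eps0 dl0 dlr dlq; set rho := L / r in dlr *; set q := _ / eps in dlq *.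
have q_gt0 : 0 < q by apply: lt_le_trans dlq; lra.
have ln1d_gt0 : 0 < ln (1 + delta) by apply: ln_gt0; lra.
have lnq_ge : ln (1 + delta) <= ln q by rewrite ler_ln// posrE; lra.
have rho_gt0 : 0 < rho by exact: lt_le_trans dlr.
have lnq_gt0 : 0 < ln q by exact: lt_le_trans lnq_ge.
set a := (rho + 1) * ln q; have a_ge0 : 0 <= a by rewrite mulr_ge0 ?ltW//; lra.
pose m := (Num.truncn a).+1.
have a_lt_m : a < m%:R := truncnS_gt a.
have m_le : m%:R <= a + 1 by rewrite -natr1 lerD2r truncn_le.
exists m.+1; last first.
  have e_le : e m.+1 <= L * d m.
    have := d_descent m; have := mulr_ge0 (ltW L_gt0) (d_ge0 m.+1); lra.
  apply: (le_lt_trans e_le).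
  have /(ler_wpM2l (ltW L_gt0))/le_lt_trans := descent_exp_decay m; apply.
  have -> : L * (d 0%N * expR (- (m%:R / (rho + 1)))) =
      eps * (q / expR (m%:R / (rho + 1))).
    by rewrite expRN /q; field; rewrite !lt0r_neq0//= expR_gt0.
  rewrite -[ltRHS]mulr1 ltr_pM2l// ltr_pdivrMr ?expR_gt0// mul1r.
  rewrite -[ltLHS]lnK ?posrE// ltr_expR ltr_pdivlMr; last lra.
  by rewrite mulrC.
have lnq_le : ln q <= delta^-1 * (rho * ln q).
  by rewrite mulrA ler_peMl ?(ltW lnq_gt0)// mulrC ler_pdivlMr// mul1r.
have two_le : 2 <= 2 / (delta * ln (1 + delta)) * (rho * ln q).
  rewrite -[leRHS]mulrA ler_peMr// mulrC ler_pdivlMr ?mulr_gt0// mul1r.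
  by apply: ler_pM => //; exact: ltW.
rewrite -natr1; apply: (@le_trans _ _ (a + 2)); first lra.
rewrite mulrDl mulrDl mul1r; apply: lerD two_le.
by rewrite /a mulrDl mul1r lerD2l.
Qed.

End rates.

(** * Attainment of the relative constants, and one mirror descent step *)

Section bregman_constants.
Variables (R : realType) (n : nat) (f h : 'rV[R]_n -> \bar R).
Variable X : set 'rV[R]_n.
Implicit Types (x y z : 'rV[R]_n).

(** The infimum is itself admissible: divide by D_h where it is positive; where it is zero,
    finiteness of the infimum supplies an admissible [M], which gives D_f <= 0. *)
Lemma rel_smoothness_le (L : R) x y : rel_smoothness f h X = L%:E ->
  0 <= bregman h y x -> X x -> X y -> bregman f y x <= L * bregman h y x.
Proof.
move=> LE; rewrite le_eqVlt => /predU1P[h0|h_gt0] Xx Xy.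
  have : rel_smoothness f h X \is a fin_num by rewrite LE.
  move=> /(lb_ereal_inf_adherent ltr01)[_ [M [_ smoothM] _] _].
  by have := smoothM x y Xx Xy; rewrite -h0 !mulr0.
rewrite -ler_pdivrMr// -lee_fin -LE; apply: le_ereal_inf_tmp.
move=> _ [M [_ smoothM] <-]; rewrite lee_fin ler_pdivrMr//.
exact: smoothM.
Qed.

(** Same division argument for the supremum; at zero distance only f(x) >= f* remains. A real [c]
    below the constant, rather than its value, also covers an infinite constant. *)
Lemma rel_growth_le (c : R) x : (c%:E <= rel_growth f h X)%E -> X x ->
  f x \is a fin_num -> fmin f X \is a fin_num ->
  0 <= bregman h (bregman_proj f h X x) x ->
  c * bregman h (bregman_proj f h X x) x <= fine (f x) - fine (fmin f X).
Proof.
move=> cE Xx fx fX; rewrite le_eqVlt => /predU1P[<-|h_gt0].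
  rewrite mulr0 subr_ge0; apply: fine_le => //.
  by apply: ereal_inf_lbound; exists x.
rewrite -ler_pdivlMr// -lee_fin; apply: (le_trans cE); apply: ge_ereal_sup.
move=> _ [M [_ growthM] <-]; rewrite lee_fin ler_pdivlMr//.
by have := growthM x Xx; rewrite -(fineK fx) -(fineK fX) -EFinB lee_fin.
Qed.

Lemma bregman_projP x : bregman_proj_defined f h X -> X x ->
  argmin (Xstar f X) (fun y => bregman h y x) (bregman_proj f h X x).
Proof. by move=> /[apply] -[y [ymin _]]; apply: getPex; exists y. Qed.

Lemma bregman_set_proj x : bregman_proj_defined f h X -> X x ->
  bregman_set h (Xstar f X) x = (bregman h (bregman_proj f h X x) x)%:E.
Proof.
move=> projX Xx; have [Xp pmin] := bregman_projP projX Xx.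
apply/eqP; rewrite eq_le; apply/andP; split.
  by apply: ereal_inf_lbound; exists (bregman_proj f h X x).
by apply: le_ereal_inf_tmp => _ [y Xy <-]; rewrite lee_fin; exact: pmin.
Qed.

Lemma mirror_step_descent (L : R) x y z :
  convex_set (X : set (convex_lmodType 'rV[R]_n)) ->
  econvex_on X f -> (forall z, X z -> ediff f z) ->
  econvex_on X h -> (forall z, X z -> ediff h z) ->
  rel_smoothness f h X = L%:E -> 0 < L -> X x -> X y ->
  argmin X (fun y => dotv (grad f x) y + L * bregman h y x) z ->
  L * bregman h y z <= L * bregman h y x - (fine (f z) - fine (f y)).
Proof.
move=> cX cf df ch dh LE L0 Xx Xy zmin; have [Xz _] := zmin.
have := bregman_argmin cX L0 (dh _ Xz) zmin Xy.
have := bregman_ge0 cf cX df Xx Xy.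
have := rel_smoothness_le LE (bregman_ge0 ch cX dh Xx Xz) Xx Xz.
rewrite /bregman !dotvBr; lra.
Qed.

End bregman_constants.

(* The O(.) of the second claim: [C delta] does not depend on the instance
   (n, f, h, X, the iterates) nor on eps, and bounds the iteration count over
   the whole regime  L/mu >= delta,  L D_h(X*,x_0)/eps >= 1 + delta. *)
Theorem proposition7 (R : realType) :
  exists C : R -> R,
  forall (n : nat) (f h : 'rV[R]_n -> \bar R) (X : set 'rV[R]_n)
    (Lk : nat -> R) (x : nat -> 'rV[R]_n) (L : R) (mu : \bar R),
  (forall z, f z != -oo%E) ->
  econvex_on setT f ->
  convex_set (X : set (convex_lmodType 'rV[R]_n)) ->
  X `<=` edom f ->
  (forall z, X z -> ediff f z) ->
  (forall z, h z != -oo%E) ->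
  econvex_on X h ->
  (forall z, X z -> ediff h z) ->
  fmin f X \is a fin_num ->
  Xstar f X !=set0 ->
  bregman_proj_defined f h X ->
  rel_smoothness f h X = L%:E ->
  rel_growth f h X = mu ->
  (0 < mu)%E ->
  mirror_descent f h X Lk x ->
  (forall k, Lk k = L) ->
  (forall k : nat,
     let K := `|Num.ceil (fine ((2 * L)%:E / mu))|%N in
     (bregman_set h (Xstar f X) (x (k + K)%N)
        <= bregman_set h (Xstar f X) (x k) / 2%:E)%E)
  /\
  (forall delta eps : R, 0 < delta -> 0 < eps ->
     (delta%:E <= L%:E / mu)%E ->
     ((1 + delta)%:E <= L%:E * bregman_set h (Xstar f X) (x 0%N) / eps%:E)%E ->
     exists k : nat,
       [/\ k%:R <= C delta * (fine (L%:E / mu)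
             * ln (fine (L%:E * bregman_set h (Xstar f X) (x 0%N) / eps%:E))),
           X (x k) &
           (f (x k) - fmin f X < eps%:E)%E]).
Proof.
exists (fun delta => 1 + delta^-1 + 2 / (delta * ln (1 + delta))).
move=> n f h X Lk x L mu _ cf cX _ df _ ch dh fX _ projX LE muE mu_gt0.
move=> [X0 xstep] LkE.
have cfX : econvex_on X f by move=> y z t _ _; exact: cf.
have Xx k : X (x k) by case: k => [//|k]; have [_ []] := xstep k.
have L_gt0 : 0 < L by rewrite -(LkE 0%N); have [] := xstep 0%N.
have ffin k : f (x k) \is a fin_num by exact/ediff_fin/df.
pose p k := bregman_proj f h X (x k).
pose d k := bregman h (p k) (x k).
pose e k := fine (f (x k)) - fine (fmin f X).
have pP k : argmin (Xstar f X) (fun y => bregman h y (x k)) (p k).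
  exact: bregman_projP.
have dE k : bregman_set h (Xstar f X) (x k) = (d k)%:E.
  exact: bregman_set_proj.
have eE k : (f (x k) - fmin f X = (e k)%:E)%E.
  by rewrite -(fineK (ffin k)) -(fineK fX).
have d_ge0 k : 0 <= d k.
  by have [[Xp _] _] := pP k; exact: bregman_ge0 ch cX dh (Xx k) Xp.
have d_descent k : L * d k.+1 <= L * d k - e k.+1.
  have [[Xp fp] _] := pP k; have [_] := xstep k; rewrite LkE => xmin.
  have := mirror_step_descent cX cfX df ch dh LE L_gt0 (Xx k) Xp xmin.
  (* The comparison point is [p k]; minimality of [p k.+1] turns its distance to the new iterate
     into an upper bound for [d k.+1]. *)
  rewrite fp; apply: le_trans; rewrite ler_pM2l//.
  by have [_] := pP k.+1; apply; have [] := pP k.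
have growth c k : (c%:E <= mu)%E -> c * d k <= e k.
  rewrite -muE => cmu; exact: rel_growth_le cmu (Xx k) (ffin k) fX (d_ge0 k).
case: mu muE mu_gt0 growth => [r||//] muE mu_gt0 growth.
- have r_gt0 : 0 < r by rewrite lte_fin in mu_gt0.
  have gr k : r * d k <= e k by exact: growth.
  have divE c : (c%:E / r%:E)%E = (c / r)%:E by rewrite inver gt_eqF.
  split=> [k/=|delta eps delta0 eps0].
    rewrite !dE divE (inver 2) pnatr_eq0/= -EFinM lee_fin.
    apply: (descent_halving L_gt0 r_gt0 d_ge0 d_descent gr).
    rewrite -ler_pdivrMr// natr_absz ger0_norm ?ceil_ge//.
    by rewrite ceil_ge0 (lt_le_trans (ltrN10 _))// divr_ge0 ?(ltW r_gt0)//
      mulr_ge0 ?(ltW L_gt0).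
  rewrite divE dE (inver eps) gt_eqF// -!EFinM !lee_fin/= => dlr dlq.
  have [k kC ek] := descent_iteration_bound L_gt0 r_gt0 d_ge0 d_descent gr
    eps0 delta0 dlr dlq.
  by exists k; split; rewrite ?eE ?lte_fin.
(* Division by +oo gives 0: the regime delta <= L/mu contradicts delta > 0, and K = 0 makes the
   halving claim require [d k = 0]. *)
- split=> [k/=|delta eps delta0 _]; last first.
    by rewrite invey mule0 lee_fin leNgt delta0.
  rewrite mulr0 ceil0 addn0 !dE; suff -> : d k = 0 by rewrite mul0e.
  apply: le_anti; rewrite d_ge0 andbT leNgt; apply/negP => dk_gt0.
  have := growth ((e k + 1) / d k) k (leey _).
  by rewrite divfK ?gt_eqF//; lra.
Qed.
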